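(* Let $X$ be a nonempty subset of $\mathbb{R}^n$, let $f_i, g_j : X\to\mathbb{R}$ ($i=1,\dots,p$, $j=1,\dots,m$), and let $\Omega=\{x\in X : g_j(x)\leqslant 0,\ j=1,\dots,m\}$. If $f_1,\dots,f_p$ are locally Lipschitz at $x_\circ\in\Omega$, then $x_\circ$ is a local quasi efficient solution of the problem $(VP)$ of minimizing $(f_1(x),\dots,f_p(x))$ over $x\in\Omega$.
   Context: Notation: $B(x,\delta)=\{y\in\mathbb{R}^n : \|y-x\|<\delta\}$; $\operatorname{int}(\mathbb{R}^p_+)$ is the set of vectors in $\mathbb{R}^p$ with all components positive. Locally Lipschitz: a function $h:X\to\mathbb{R}$ is locally Lipschitz at $x\in X$ if there exist $L\geqslant 0$ and $\delta>0$ such that $|h(y)-h(z)|\leqslant L\|y-z\|$ for all $y,z\in B(x,\delta)\cap X$. Local quasi efficient solution: a feasible point $x_\circ\in\Omega$ is a local quasi efficient solution of $(VP)$ if there exist $\alpha\in\operatorname{int}(\mathbb{R}^p_+)$ and $\delta>0$ such that for any $x\in\Omega\cap B(x_\circ,\delta)$ the following cannot hold (simultaneously): $$f_i(x)\leqslant f_i(x_\circ)-\alpha_i\|x-x_\circ\|\quad\text{for all } i=1,\dots,p,$$ $$f_r(x)<f_r(x_\circ)-\alpha_r\|x-x_\circ\|\quad\text{for some } r\in\{1,\dots,p\}.$$ *)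

(* Defs.v *)
From mathcomp Require Import all_boot all_order all_algebra.
From mathcomp Require Import classical_sets reals.

Set Implicit Arguments.
Unset Strict Implicit.
Unset Printing Implicit Defensive.

Import Order.TTheory GRing.Theory Num.Theory.

Local Open Scope classical_set_scope.
Local Open Scope ring_scope.

(* The Euclidean norm; MathComp-Analysis's `|x| on matrices is the sup norm. *)
Definition enorm (R : realType) (n : nat) (x : 'rV[R]_n) : R :=
  Num.sqrt (\sum_(i < n) x 0 i ^+ 2).

Definition eball (R : realType) (n : nat) (x : 'rV[R]_n) (delta : R) :
  set 'rV[R]_n := [set y | enorm (y - x) < delta].

(* A function on X : set 'rV[R]_n has the subtype {x | x \in X} as its domain,
   through the coercion set_type; val embeds that subtype in 'rV[R]_n, and a
   subset of X is a set over the subtype. *)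
Definition locally_lipschitz_at (R : realType) (n : nat) (X : set 'rV[R]_n)
    (h : X -> R) (x : X) : Prop :=
  exists L delta : R,
    [/\ 0 <= L, 0 < delta &
      forall y z : X, eball (val x) delta (val y) ->
        eball (val x) delta (val z) ->
        `|h y - h z| <= L * enorm (val y - val z)].

Definition feasible_set (R : realType) (n m : nat) (X : set 'rV[R]_n)
    (g : 'I_m -> X -> R) : set X :=
  [set x | forall j : 'I_m, g j x <= 0].

Definition local_quasi_efficient (R : realType) (n p : nat)
    (X : set 'rV[R]_n) (f : 'I_p -> X -> R) (Omega : set X) (x0 : X) : Prop :=
  Omega x0 /\
  exists (alpha : 'rV[R]_p) (delta : R),
    [/\ forall i : 'I_p, 0 < alpha 0 i, 0 < delta &
      forall x : X, Omega x -> eball (val x0) delta (val x) ->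
        ~ ((forall i : 'I_p,
              f i x <= f i x0 - alpha 0 i * enorm (val x - val x0)) /\
           (exists r : 'I_p,
              f r x < f r x0 - alpha 0 r * enorm (val x - val x0)))].

(* Main.v *)
Require Import Defs.
From mathcomp Require Import all_boot all_order all_algebra.
From mathcomp Require Import classical_sets reals.

Local Open Scope classical_set_scope.
Local Open Scope ring_scope.

Import Order.TTheory GRing.Theory Num.Theory.

(** A function that is Lipschitz near x0 with constant L cannot fall below its
    value at x0 faster than linearly with slope L ([lipschitz_lower_bound]).
    So if each weight alpha_i is positive and at least a Lipschitz constant of
    f_i, a strict decrease of some f_r by more than alpha_r times the distance to x0 is
    impossible on the ball where f_r is Lipschitz.  There are finitely many
    objectives, so their balls contain a common one ([common_radius]). *)

Lemma enorm_ge0 (R : realType) (n : nat) (x : 'rV[R]_n) : 0 <= enorm x.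
Proof. exact: sqrtr_ge0. Qed.

Lemma eball_center (R : realType) (n : nat) (x : 'rV[R]_n) (delta : R) :
  0 < delta -> eball x delta x.
Proof.
move=> delta_gt0; rewrite /eball /= /enorm subrr big1 ?sqrtr0 // => i _.
by rewrite mxE expr0n.
Qed.

(** The Lipschitz inequality with one of the two points fixed at the centre; a
    Lipschitz constant may vanish, but any larger one also works, so L can be
    taken positive and serve as a weight. *)
Lemma lipschitz_lower_bound (R : realType) (n : nat) (X : set 'rV[R]_n)
    (h : X -> R) (x0 : X) :
  locally_lipschitz_at h x0 ->
  exists L delta : R,
    [/\ 0 < L, 0 < delta &
      forall x : X, eball (val x0) delta (val x) ->
        h x0 - L * enorm (val x - val x0) <= h x].
Proof.
move=> [L [delta [L_ge0 delta_gt0 lip]]].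
exists (L + 1), delta; split=> // [|x x_near].
  exact: ltr_wpDl.
have := lip x x0 x_near (eball_center _ _ _ _ delta_gt0).
rewrite distrC => /(le_trans (ler_norm _)) drop.
rewrite lerBlDr -lerBlDl (le_trans drop) // ler_wpM2r ?enorm_ge0 //.
by rewrite lerDl.
Qed.

Lemma common_radius (R : realType) (p : nat) (delta : 'I_p -> R) :
  (forall i, 0 < delta i) ->
  exists2 d : R, 0 < d & forall i, d <= delta i.
Proof.
(* The default value 1 keeps the minimum positive when p = 0. *)
move=> delta_gt0; exists (\big[Num.min/1]_(i < p) delta i).
  by apply: lt_bigmin => // i _; exact: delta_gt0.
by move=> i; exact: bigmin_le.
Qed.

Theorem mainTheorem2 (R : realType) (n p m : nat) (X : set 'rV[R]_n)
    (X_nonempty : X !=set0)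
    (f : 'I_p -> X -> R) (g : 'I_m -> X -> R) (x0 : X)
    (x0_feasible : feasible_set g x0)
    (f_lipschitz : forall i : 'I_p, locally_lipschitz_at (f i) x0) :
  local_quasi_efficient f (feasible_set g) x0.
Proof.
split=> //.
have /fin_all_exists[L /fin_all_exists[delta bound]] :=
  fun i => lipschitz_lower_bound _ _ _ _ _ (f_lipschitz i).
have [|d d_gt0 d_le] := common_radius _ _ delta.
  by move=> i; case: (bound i).
exists (\row_i L i), d; split=> // [i|x _ x_near [_ [r]]].
  by rewrite mxE; case: (bound i).
have [_ _ /(_ x (lt_le_trans x_near (d_le r)))] := bound r.
by rewrite mxE leNgt => /negP.
Qed.
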